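(* Let $\mathcal{A}\in\mathbb{C}^{h\times n\times r}$, $\mathcal{B}\in\mathbb{C}^{h\times k\times r}$, $\mathcal{C}\in\mathbb{C}^{a\times b\times r}$, $\mathcal{D}\in\mathbb{C}^{l\times d\times r}$, and let $p$ be a positive integer with $p=\frac{l}{a}=\frac{n}{k}$ and $b=d$. Write $\mathcal{A}=[\widetilde{\mathcal{A}}_1\ \widetilde{\mathcal{A}}_2\ \cdots\ \widetilde{\mathcal{A}}_p]$ with $\widetilde{\mathcal{A}}_g\in\mathbb{C}^{h\times k\times r}$ consisting of the lateral slices $(g-1)k+1,\dots,gk$ of $\mathcal{A}$. Then the system $\mathcal{A}\ltimes X=\mathcal{B}$, $X\ltimes\mathcal{C}=\mathcal{D}$ with unknown vector $X\in\mathbb{C}^p$ admits a solution if and only if the following two conditions hold: (i) the tensors $\widetilde{\mathcal{A}}_1,\widetilde{\mathcal{A}}_2,\dots,\widetilde{\mathcal{A}}_p$ and $\mathcal{B}$ are linearly dependent; (ii) the entries of $\mathcal{D}$ satisfy $d_{t+(g-1)a,\,j,\,i}=\alpha_g\,c_{t,j,i}$, where $\alpha_g\in\mathbb{C}$, $t=1,\dots,a$, $g=1,\dots,p$, $j=1,\dots,d$ and $i=1,\dots,r$. Here the solution vector is $X=[\alpha_1,\alpha_2,\dots,\alpha_p]^T$. Moreover, the solution is unique except in the case where $\mathcal{C}$ and $\mathcal{D}$ are zero and the tensors $\widetilde{\mathcal{A}}_1,\dots,\widetilde{\mathcal{A}}_p$ remain linearly dependent according to condition (i).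
   Context: Tensors are third-order arrays over $\mathbb{C}$, with all dimensions positive integers; $c_{t,j,i}$ and $d_{t,j,i}$ are the entries of $\mathcal{C}$ and $\mathcal{D}$. A vector in $\mathbb{C}^p$ is regarded as a $p\times 1\times 1$ tensor. The $j$-th lateral slice of a tensor is obtained by fixing the second index equal to $j$. $[x,y]$ denotes the least common multiple of two integers. $I_{n\times n\times k}$ is the identity tensor: its first frontal slice (third index equal to 1) is the $n\times n$ identity matrix and its other frontal slices are zero. The Kronecker product of $\mathcal{A}\in\mathbb{C}^{n_1\times n_2\times n_3}$ and $\mathcal{B}\in\mathbb{C}^{p_1\times p_2\times p_3}$ is the $n_1p_1\times n_2p_2\times n_3p_3$ tensor whose entry at position $((i_1-1)p_1+j_1,(i_2-1)p_2+j_2,(i_3-1)p_3+j_3)$ is $a_{i_1i_2i_3}b_{j_1j_2j_3}$. The t-product of $\mathcal{A}\in\mathbb{C}^{m\times n\times r}$ and $\mathcal{B}\in\mathbb{C}^{n\times s\times r}$ is $\mathcal{A}*\mathcal{B}\in\mathbb{C}^{m\times s\times r}$ whose $k$-th frontal slice is $\sum_{i+j\equiv k+1\ (\mathrm{mod}\ r)}\mathcal{A}_{(::i)}\mathcal{B}_{(::j)}$ (sum over $1\le i,j\le r$), where $\mathcal{A}_{(::i)}$ is the $i$-th frontal slice. The semi-tensor product of $\mathcal{A}\in\mathbb{C}^{m\times n\times r}$ and $\mathcal{B}\in\mathbb{C}^{p\times q\times s}$ is $\mathcal{A}\ltimes\mathcal{B}=(\mathcal{A}\otimes I_{\frac{t}{n}\times\frac{t}{n}\times\frac{e}{r}})*(\mathcal{B}\otimes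 I_{\frac{t}{p}\times\frac{t}{p}\times\frac{e}{s}})\in\mathbb{C}^{\frac{mt}{n}\times\frac{qt}{p}\times e}$, where $t=[n,p]$ and $e=[r,s]$.
   Formalization: Besides (i) and (ii), the conditions require B = α_1 A_1 + ... + α_p A_p with the same α_g as in (ii); linear dependence alone does not suffice (p = 1, A = 0, B ≠ 0, C = D ≠ 0 satisfies (i) and (ii) but has no solution). *)

(* Defs.v *)
From HB Require Import structures.
From mathcomp Require Import all_boot all_order all_algebra.
From mathcomp Require Export reals.
From mathcomp.real_closed Require Export complex mxtens.

Set Implicit Arguments.
Unset Strict Implicit.
Unset Printing Implicit Defensive.

Import GRing.Theory.
Local Open Scope ring_scope.

(* An m x n x r tensor is the family of its r frontal slices: the entry at
   position (i1, i2, i3) is A i3 i1 i2.  All indices start at 0.  This is a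
   notation so that the module and vector space structures of finite functions
   and matrices apply directly. *)
Notation tensor K m n r := {ffun 'I_r -> 'M[K]_(m, n)}.

Definition tcast (K : Type) (m n r m' n' r' : nat)
    (em : m = m') (en : n = n') (er : r = r') (A : tensor K m n r) :
    tensor K m' n' r' :=
  [ffun i => castmx (em, en) (A (cast_ord (esym er) i))].

(* Equality of tensors whose dimensions are equal as numbers but need not be
   convertible; it asserts in particular that the dimensions agree. *)
Definition teq (K : Type) (m n r m' n' r' : nat)
    (A : tensor K m n r) (B : tensor K m' n' r') : Prop :=
  exists (em : m = m') (en : n = n') (er : r = r'), tcast em en er A = B.

Definition vec_tensor (K : Type) (p : nat) (X : 'cV[K]_p) : tensor K p 1 1 :=
  [ffun=> X].

Section TensorOperations.
Variable K : fieldType.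

Definition id_tensor (n k : nat) : tensor K n n k :=
  [ffun i : 'I_k => if (i : nat) == 0%N then 1%:M else 0].

(* [mxtens_unindex] maps i1 * p1 + j1 to (i1, j1), and [*t] is the Kronecker
   product of matrices with the same indexing. *)
Definition tkron (n1 n2 n3 p1 p2 p3 : nat)
    (A : tensor K n1 n2 n3) (B : tensor K p1 p2 p3) :
    tensor K (n1 * p1) (n2 * p2) (n3 * p3) :=
  [ffun i => A (mxtens_unindex i).1 *t B (mxtens_unindex i).2].

(* With indices starting at 0 the condition i + j = k + 1 (mod r) on frontal
   slices becomes i + j = k (mod r). *)
Definition tprod (m n s r : nat) (A : tensor K m n r) (B : tensor K n s r) :
    tensor K m s r :=
  [ffun k : 'I_r =>
     \sum_(i < r) \sum_(j < r | (i + j == k %[mod r])%N) A i *m B j].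

Lemma mul_lcmn_divl (n p : nat) : (n * (lcmn n p %/ n) = lcmn n p)%N.
Proof. by rewrite mulnC divnK // dvdn_lcml. Qed.

Lemma mul_lcmn_divr (n p : nat) : (p * (lcmn n p %/ p) = lcmn n p)%N.
Proof. by rewrite mulnC divnK // dvdn_lcmr. Qed.

Definition stp (m n r p q s : nat) (A : tensor K m n r) (B : tensor K p q s) :
    tensor K (m * (lcmn n p %/ n)) (q * (lcmn n p %/ p)) (lcmn r s) :=
  let t := lcmn n p in let e := lcmn r s in
  tprod
    (tcast erefl (mul_lcmn_divl n p) (mul_lcmn_divl r s)
       (tkron A (id_tensor (t %/ n) (e %/ r))))
    (tcast (mul_lcmn_divr n p) erefl (mul_lcmn_divr r s)
       (tkron B (id_tensor (t %/ p) (e %/ s)))).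

(* The lateral slices g * k, ..., g * k + k - 1 of A, since
   [mxtens_index (g, j)] has value g * k + j. *)
Definition lateral_block (h n r p k : nat) (Hn : n = (p * k)%N)
    (A : tensor K h n r) (g : 'I_p) : tensor K h k r :=
  [ffun i => \matrix_(s < h, j < k)
     A i s (cast_ord (esym Hn) (mxtens_index (g, j)))].

Definition lateral_blocks (h n r p k : nat) (Hn : n = (p * k)%N)
    (A : tensor K h n r) : seq (tensor K h k r) :=
  [seq lateral_block Hn A g | g <- enum 'I_p].

Definition linearly_dependent (V : vectType K) (s : seq V) : Prop := ~~ free s.

Definition stp_solution (h n r k a b l d p : nat)
    (A : tensor K h n r) (B : tensor K h k r)
    (C : tensor K a b r) (D : tensor K l d r) (X : 'cV[K]_p) : Prop :=
  teq (stp A (vec_tensor X)) B /\ teq (stp (vec_tensor X) C) D.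

(* B = alpha_1 A_1 + ... + alpha_p A_p: the linear dependence relation of
   A_1, ..., A_p, B whose coefficients are those of the solution vector. *)
Definition dependence_coeffs (h n r p k : nat) (Hn : n = (p * k)%N)
    (A : tensor K h n r) (B : tensor K h k r) (alpha : 'cV[K]_p) : Prop :=
  B = \sum_(g < p) alpha g 0 *: lateral_block Hn A g.

Definition entries_proportional (a b r l d p : nat)
    (Hl : l = (p * a)%N) (Hbd : b = d)
    (C : tensor K a b r) (D : tensor K l d r) (alpha : 'cV[K]_p) : Prop :=
  forall (t : 'I_a) (g : 'I_p) (j : 'I_b) (i : 'I_r),
    D i (cast_ord (esym Hl) (mxtens_index (g, t))) (cast_ord Hbd j)
      = alpha g 0 * C i t j.

End TensorOperations.

(* Main.v *)
Require Import Defs.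
From mathcomp Require Import all_boot all_order all_algebra.
Import GRing.Theory.
Local Open Scope ring_scope.

(* Kronecker products with identity tensors are concentrated in the first
   frontal slice whenever the other factor has a single frontal slice, so each
   of the two t-products reduces to slicewise matrix products.  Entrywise,
   stp A X = B then says that B = sum_g X_g A_g, and stp X C = D says that the
   g-th block of rows of D is X_g C.  The first condition has at most one
   solution X when the A_g are free, the second one when C is nonzero; in the
   remaining case C = D = 0 a dependence relation among the A_g can be added
   to any solution. *)

Section TensorProducts.
Set Implicit Arguments.
Unset Strict Implicit.
Context {K : fieldType}.

Lemma tcastE m n r m' n' r' (em : m = m') (en : n = n') (er : r = r')
    (A : tensor K m n r) (i : 'I_r') (s : 'I_m') (j : 'I_n') :
  Defs.tcast em en er A i s j
    = A (cast_ord (esym er) i) (cast_ord (esym em) s) (cast_ord (esym en) j).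
Proof. by rewrite ffunE castmxE. Qed.

(** The existential proofs hidden in [teq] are irrelevant: casts preserve the values of indices, so
    any chosen [em], [en], [er] give the same entries. *)
Lemma teqP m n r m' n' r' (em : m = m') (en : n = n') (er : r = r')
    (A : tensor K m n r) (B : tensor K m' n' r') :
  teq A B <-> forall i s j, Defs.tcast em en er A i s j = B i s j.
Proof.
split=> [[em' [en' [er' <-]]] | AB].
  by move=> i s j; rewrite !tcastE; congr (A _ _ _); apply: val_inj.
exists em, en, er.
by apply/ffunP=> i; apply/matrixP=> s j; apply: AB.
Qed.

Lemma modn_ordK r (k : 'I_r) : (k %% r)%N = k.
Proof. exact: modn_small. Qed.

(** Only the terms with [j = 0] survive, and then [i = k] modulo [r] forces [i = k], both being
    smaller than [r]. *)
Lemma tprod_slice0r m n s r (F : tensor K m n r) (G : tensor K n s r)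
    (i0 k : 'I_r) :
  i0 = 0%N :> nat -> (forall i : 'I_r, i <> 0%N :> nat -> G i = 0) ->
  tprod F G k = F k *m G i0.
Proof.
move=> i00 G0; rewrite ffunE (bigD1 k) //= [X in _ + X]big1 => [|i /eqP ik].
  rewrite addr0 (bigD1 i0) /=; last by rewrite i00 addn0.
  rewrite big1 ?addr0 // => j /andP[_ ji0]; rewrite G0 ?mulmx0 // => j0.
  by case/eqP: ji0; apply: val_inj; rewrite /= i00.
apply: big1 => j /eqP ijk; rewrite G0 ?mulmx0 // => j0; case: ik.
by apply: val_inj; rewrite /= -[LHS]modn_ordK -[RHS]modn_ordK -ijk j0 addn0.
Qed.

Lemma tprod_slice0l m n s r (F : tensor K m n r) (G : tensor K n s r)
    (i0 k : 'I_r) :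
  i0 = 0%N :> nat -> (forall i : 'I_r, i <> 0%N :> nat -> F i = 0) ->
  tprod F G k = F i0 *m G k.
Proof.
move=> i00 F0; rewrite ffunE (bigD1 i0) //= [X in _ + X]big1 => [|i /eqP ii0].
  rewrite addr0 (bigD1 k) /=; last by rewrite i00 add0n.
  rewrite big1 ?addr0 // => j /andP[/eqP jk]; case/eqP; apply: val_inj.
  by rewrite /= -[LHS]modn_ordK -[RHS]modn_ordK -jk i00.
apply: big1 => j _; rewrite F0 ?mul0mx // => i_0; case: ii0.
by apply: val_inj; rewrite /= i_0 i00.
Qed.

Lemma tkron_id_slice n1 n2 u r (X : tensor K n1 n2 1) (i : 'I_(1 * r)) :
  tkron X (id_tensor K u r) i
    = if (i : nat) == 0%N then X 0 *t 1%:M else 0.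
Proof.
rewrite !ffunE /= modn_small; last by rewrite -[r in (_ < r)%N]mul1n.
by rewrite (ord1 (Ordinal _)); case: eqP => // _; rewrite tensmx0.
Qed.

Lemma tkron_id1E m n r (A : tensor K m n r) (i : 'I_(r * 1))
    (s : 'I_(m * 1)) (j : 'I_(n * 1)) :
  tkron A (id_tensor K 1 1) i s j
    = A (cast_ord (muln1 r) i) (cast_ord (muln1 m) s) (cast_ord (muln1 n) j).
Proof.
rewrite !ffunE /= modn1 /= mxE [1%:M _ _]mxE (ord1 (_.2)) (ord1 (_.2)) eqxx mulr1.
by congr (A _ _ _); apply: val_inj; rewrite /= divn1.
Qed.

(* The sizes u, v, w, x, t, e stand for the quotients and lcms in stp; as
   variables constrained by equations they can be substituted away. *)
Lemma tprod_vec_tensorr h r p k t e u v w x (A : tensor K h (p * k) r)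
    (X : 'cV[K]_p) (E1 : (p * k * u = t)%N) (E2 : (r * w = e)%N)
    (E3 : (p * v = t)%N) (E4 : (1 * x = e)%N)
    (em : (h * u = h)%N) (en : (1 * v = k)%N) (er : e = r)
    (i : 'I_r) (s : 'I_h) (j : 'I_k) :
  Defs.tcast em en er
    (tprod (Defs.tcast erefl E1 E2 (tkron A (id_tensor K u w)))
           (Defs.tcast E3 erefl E4 (tkron (vec_tensor X) (id_tensor K v x)))) i s j
    = \sum_(g < p) X g 0 * A i s (mxtens_index (g, j)).
Proof.
(* The indices [s] and [i] show that [h] and [r] are positive, so [em] and [E2] can be cancelled to
   give [u = w = 1]. *)
have h_gt0 : (0 < h)%N by case: (h) s => [[]|].
have r_gt0 : (0 < r)%N by case: (r) i => [[]|].
have u1 : u = 1%N by apply/eqP; rewrite -(eqn_pmul2l h_gt0) em muln1.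
have w1 : w = 1%N by apply/eqP; rewrite -(eqn_pmul2l r_gt0) E2 er muln1.
have vk : v = k by rewrite -en mul1n.
subst u w v t e.
rewrite tcastE (@tprod_slice0r _ _ _ _ _ _
  (cast_ord (esym er) (Ordinal r_gt0))) //; last first.
  move=> i' i'0; apply/matrixP=> s' j'; rewrite tcastE tkron_id_slice /=.
  by rewrite (introF eqP i'0) !mxE.
(* The contracted index splits into a pair: a block number [g] and a position [q] inside the
   block. *)
rewrite mxE (reindex (fun q => cast_ord E3 (mxtens_index q))) /=; last first.
  exists (fun q => mxtens_unindex (cast_ord (esym E3) q)) => q _.
    by rewrite cast_ordK mxtens_indexK.
  by rewrite mxtens_unindexK cast_ordKV.
(* The factor [(q == j)%:R] is the entry of the identity matrix in the Kronecker product with [X];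
   it collapses the inner sum. *)
transitivity (\sum_(g < p) \sum_(q < k)
    (q == j)%:R * (X g 0 * A i s (mxtens_index (g, q)))); last first.
  apply: eq_bigr => g _; rewrite (bigD1 j) //= eqxx mul1r big1 ?addr0 // => q.
  by case: eqP => // _ _; rewrite mul0r.
rewrite pair_bigA; apply: eq_bigr => -[g q] _ /=.
rewrite !tcastE tkron_id1E tkron_id_slice /= cast_ordK.
have -> : cast_ord erefl (cast_ord (esym en) j) = mxtens_index (0, j)
  by apply: val_inj.
rewrite tensmxE ffunE mxE mulrC [X g 0 * (_ == _)%:R]mulrC -mulrA; congr (_ * (_ * _)).
by congr (A _ _ _); apply: val_inj.
Qed.

(** The first slice of the left factor stacks the scalar matrices [X g 0 *: 1%:M] of size [a], so
    its [g]-th block of rows scales [C]. *)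
Lemma tprod_vec_tensorl a b r p t e u v w x (X : 'cV[K]_p) (C : tensor K a b r)
    (E1 : (1 * u = t)%N) (E2 : (1 * w = e)%N)
    (E3 : (a * v = t)%N) (E4 : (r * x = e)%N)
    (em : (p * u = p * a)%N) (en : (b * v = b)%N) (er : e = r)
    (i : 'I_r) (g : 'I_p) (s : 'I_a) (j : 'I_b) :
  Defs.tcast em en er
    (tprod (Defs.tcast erefl E1 E2 (tkron (vec_tensor X) (id_tensor K u w)))
           (Defs.tcast E3 erefl E4 (tkron C (id_tensor K v x))))
    i (mxtens_index (g, s)) j
    = X g 0 * C i s j.
Proof.
have b_gt0 : (0 < b)%N by case: (b) j => [[]|].
have r_gt0 : (0 < r)%N by case: (r) i => [[]|].
have v1 : v = 1%N by apply/eqP; rewrite -(eqn_pmul2l b_gt0) en muln1.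
have x1 : x = 1%N by apply/eqP; rewrite -(eqn_pmul2l r_gt0) E4 er muln1.
have ua : u = a by rewrite -[u]mul1n E1 -E3 v1 muln1.
subst u v x t e.
rewrite tcastE (@tprod_slice0l _ _ _ _ _ _
  (cast_ord (esym er) (Ordinal r_gt0))) //; last first.
  move=> i' i'0; apply/matrixP=> s' j'; rewrite tcastE tkron_id_slice /=.
  by rewrite (introF eqP i'0) !mxE.
rewrite mxE (reindex (fun q => mxtens_index (0, q))) /=; last first.
  exists (fun q => (mxtens_unindex q).2) => q _; first by rewrite mxtens_indexK.
  by case: q / mxtens_indexP => o q; rewrite mxtens_indexK (ord1 o).
rewrite (bigD1 s) //= big1 ?addr0 => [|q qs];
  rewrite !tcastE tkron_id_slice /= !cast_ord_id tensmxE ffunE mxE.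
  rewrite eqxx mulr1 tkron_id1E; congr (_ * C _ _ _); exact: val_inj.
by rewrite eq_sym (negPf qs) mulr0 mul0r.
Qed.

Lemma teq_stp_vec_tensorr h n r p k (Hn : n = (p * k)%N) (A : tensor K h n r)
    (B : tensor K h k r) (X : 'cV[K]_p) :
  (0 < p)%N -> (0 < k)%N ->
  teq (stp A (vec_tensor X)) B <-> dependence_coeffs Hn A B X.
Proof.
move=> p_gt0 k_gt0; subst n.
(* Hence [A] is padded by an identity of size 1 and [X] by one of size [k]. *)
have tpk : lcmn (p * k) p = (p * k)%N by apply/lcmn_idPl; apply: dvdn_mulr.
have em : (h * (lcmn (p * k) p %/ (p * k)) = h)%N.
  by rewrite tpk divnn muln_gt0 p_gt0 k_gt0 muln1.
have en : (1 * (lcmn (p * k) p %/ p) = k)%N by rewrite tpk mul1n mulKn.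
have er : lcmn r 1 = r by apply/lcmn_idPl.
rewrite (teqP em en er); split=> [AX | -> i s j].
  apply/ffunP=> i; apply/matrixP=> s j; rewrite -AX tprod_vec_tensorr.
  rewrite sum_ffunE summxE; apply: eq_bigr => g _.
  by rewrite !ffunE !mxE cast_ord_id.
rewrite tprod_vec_tensorr sum_ffunE summxE; apply: eq_bigr => g _.
by rewrite !ffunE !mxE cast_ord_id.
Qed.

Lemma teq_stp_vec_tensorl a b r l d p (Hl : l = (p * a)%N) (Hbd : b = d)
    (X : 'cV[K]_p) (C : tensor K a b r) (D : tensor K l d r) :
  (0 < a)%N ->
  teq (stp (vec_tensor X) C) D <-> entries_proportional Hl Hbd C D X.
Proof.
move=> a_gt0; subst l d.
have ta : lcmn 1 a = a by apply/lcmn_idPr.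
have em : (p * (lcmn 1 a %/ 1) = p * a)%N by rewrite ta divn1.
have en : (b * (lcmn 1 a %/ a) = b)%N by rewrite ta divnn a_gt0 muln1.
have er : lcmn 1 r = r by apply/lcmn_idPr.
rewrite (teqP em en er); split=> [XC t g j i | DX i s j].
  by rewrite !cast_ord_id -XC tprod_vec_tensorl.
case: s / mxtens_indexP => g t.
by rewrite tprod_vec_tensorl -DX !cast_ord_id.
Qed.

(** This is [freeP] for a family indexed by ['I_p], with [v g] in place of the [nth] of a tuple. *)
Lemma free_map_enumP (vT : vectType K) p (v : 'I_p -> vT) :
  reflect (forall c : 'I_p -> K, \sum_(g < p) c g *: v g = 0 -> forall g, c g = 0)
          (free [seq v g | g <- enum 'I_p]).
Proof.
have -> : [seq v g | g <- enum 'I_p] = mktuple v by [].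
have E c : \sum_(g < p) c g *: (mktuple v)`_g = \sum_(g < p) c g *: v g.
  by apply: eq_bigr => g _; rewrite -tnth_nth tnth_mktuple.
by apply: (iffP freeP) => Hv c c0; apply: Hv; [rewrite E | rewrite -E].
Qed.

Lemma dependence_coeffs_not_free h n r p k (Hn : n = (p * k)%N)
    (A : tensor K h n r) (B : tensor K h k r) (X : 'cV[K]_p) :
  dependence_coeffs Hn A B X ->
  linearly_dependent (rcons (lateral_blocks Hn A) B).
Proof.
move=> ->; rewrite /linearly_dependent.
(* Freeness is invariant under permutation; with [B] moved to the head, it suffices that [B] lies in
   the span of the blocks. *)
rewrite (perm_free (permEl (perm_rcons _ _))) free_cons negb_and negbK memv_suml // => g _.
by rewrite memvZ // memv_span // map_f // mem_enum.
Qed.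

(** If [X] and [Y] differ at [g], every entry of [C] is annihilated by the nonzero scalar
    [X g 0 - Y g 0], so [C] vanishes. *)
Lemma entries_proportional_inj a b r l d p (Hl : l = (p * a)%N) (Hbd : b = d)
    (C : tensor K a b r) (D : tensor K l d r) (X Y : 'cV[K]_p) :
  C != 0 -> entries_proportional Hl Hbd C D X ->
  entries_proportional Hl Hbd C D Y -> X = Y.
Proof.
move=> C0 DX DY; apply/matrixP=> g o; rewrite (ord1 o).
apply/eqP/(contraNT _ C0) => XY; apply/eqP/ffunP=> i; apply/matrixP=> t j.
rewrite !(ffunE, mxE); apply/eqP; move: (DX t g j i); rewrite DY => /eqP.
by rewrite -subr_eq0 -mulrBl mulf_eq0 subr_eq0 eq_sym (negPf XY).
Qed.

Lemma entries_proportional0 a b r l d p (Hl : l = (p * a)%N) (Hbd : b = d)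
    (X : 'cV[K]_p) :
  entries_proportional Hl Hbd (0 : tensor K a b r) (0 : tensor K l d r) X.
Proof. by move=> t g j i; rewrite !(ffunE, mxE) mulr0. Qed.

(** Every row of [D] lies in one of the [p] blocks, each a multiple of [C]. *)
Lemma entries_proportional0l a b r l d p (Hl : l = (p * a)%N) (Hbd : b = d)
    (D : tensor K l d r) (X : 'cV[K]_p) :
  entries_proportional Hl Hbd (0 : tensor K a b r) D X -> D = 0.
Proof.
subst l d => DX; apply/ffunP=> i; apply/matrixP=> s j.
case: s / mxtens_indexP => g t; move: (DX t g j i).
by rewrite !cast_ord_id !(ffunE, mxE) mulr0.
Qed.

End TensorProducts.

Theorem lemma3p2 (R : realType) (h n r k a b l d p : nat)
  (h_gt0 : (0 < h)%N) (n_gt0 : (0 < n)%N) (r_gt0 : (0 < r)%N)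
  (k_gt0 : (0 < k)%N) (a_gt0 : (0 < a)%N) (b_gt0 : (0 < b)%N)
  (l_gt0 : (0 < l)%N) (d_gt0 : (0 < d)%N) (p_gt0 : (0 < p)%N)
  (Hl : l = (p * a)%N) (Hn : n = (p * k)%N) (Hbd : b = d)
  (A : tensor R[i] h n r) (B : tensor R[i] h k r)
  (C : tensor R[i] a b r) (D : tensor R[i] l d r) :
  [/\ (exists X : 'cV[R[i]]_p, stp_solution A B C D X)
      <-> (linearly_dependent (rcons (lateral_blocks Hn A) B)
           /\ exists alpha : 'cV[R[i]]_p,
                dependence_coeffs Hn A B alpha
                /\ entries_proportional Hl Hbd C D alpha),
      (forall X : 'cV[R[i]]_p,
         stp_solution A B C D X
         <-> (dependence_coeffs Hn A B X
              /\ entries_proportional Hl Hbd C D X))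
    & (exists X : 'cV[R[i]]_p, stp_solution A B C D X) ->
      ((exists! X : 'cV[R[i]]_p, stp_solution A B C D X)
       <-> ~ [/\ C = 0, D = 0 & linearly_dependent (lateral_blocks Hn A)])].
Proof.
have solP (X : 'cV[R[i]]_p) : stp_solution A B C D X <->
    dependence_coeffs Hn A B X /\ entries_proportional Hl Hbd C D X.
  by rewrite /stp_solution (teq_stp_vec_tensorr Hn) // (teq_stp_vec_tensorl Hl Hbd).
split=> //.
  split=> [[X /solP[BX DX]] | [_ [X /solP solX]]]; last by exists X.
  by split; [apply: dependence_coeffs_not_free BX | exists X].
case=> X solX; have /solP[BX DX] := solX; split.
  (* Dependence is refuted by proving freeness: a relation [c] among the blocks yields a second
     solution [X + c], and uniqueness forces [c = 0]. *)
  move=> [X0 [_ X0_uniq]] [C0 D0] /free_map_enumP; apply=> c Ac g.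
  have solY : stp_solution A B C D (X + \col_g c g).
    apply/solP; rewrite C0 D0; split; last exact: entries_proportional0.
    rewrite /dependence_coeffs.
    under eq_bigr do rewrite !mxE scalerDl.
    by rewrite big_split /= Ac addr0.
  have /matrixP/(_ g 0) := etrans (esym (X0_uniq _ solX)) (X0_uniq _ solY).
  by rewrite !mxE => /eqP; rewrite addrC -subr_eq subrr eq_sym => /eqP.
move=> not_deg; exists X; split=> // Y /solP[BY DY].
have [C0 | C0] := eqVneq C 0; last exact: (entries_proportional_inj C0 DX DY).
(* Solvability with [C = 0] already gives [D = 0], so dependent blocks would be the excluded
   case. *)
have Afree : free (lateral_blocks Hn A).
  apply/idPn => Adep; case: not_deg; split=> //; rewrite C0 in DX.
  exact: entries_proportional0l DX.
(* Both solutions express [B] in the blocks, so [X - Y] is a vanishing combination of a free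
   family. *)
apply/matrixP=> g o; rewrite (ord1 o); apply/eqP; rewrite -subr_eq0; apply/eqP.
move: g; apply: (free_map_enumP _ Afree (fun g => X g 0 - Y g 0)).
under eq_bigr do rewrite scalerBl.
by rewrite sumrB -BX -BY subrr.
Qed.
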